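(* Let $G$ be a connected graph of order $n$ with $\alpha(G)=n-2$. Then $m_G[0,n-\alpha(G)]=\alpha(G)$ (i.e. $m_G[0,2]=n-2$) if and only if $G$ is isomorphic to one of the following, where $p\ge r\ge 0$ and $q\ge 0$ are integers with $n=p+q+r+2$: (1) $B(p,q,r)$ with $q\ge 1$ and $p+q+r\ge 3$; (2) $B'(p,0,r)$ with $pr\ge 2$; (3) $B'(p,q,r)$ with $q\ge 1$.
   Context: Graphs are finite and simple; $\alpha(G)$ is the independence number. $L(G)=D(G)-A(G)$ is the Laplacian matrix; for an interval $I$, $m_G I$ is the number of Laplacian eigenvalues of $G$ (with multiplicity) in $I$. For integers $p,q,r\ge 0$, the binary star graph $B(p,q,r)$ is the simple graph on $p+q+r+2$ vertices $u,v,w_1,\dots,w_q,u_1,\dots,u_p,v_1,\dots,v_r$ whose edges are $uw_i$ and $vw_i$ for $1\le i\le q$, $uu_j$ for $1\le j\le p$, and $vv_k$ for $1\le k\le r$ (so $u,v$ nonadjacent). $B'(p,q,r)$ is obtained from $B(p,q,r)$ by adding the edge $uv$. The convention $p\ge r$ is imposed (the graphs are symmetric in $p$ and $r$). *)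

(* Defs.v *)
From HB Require Import structures.
From mathcomp Require Import all_boot all_order all_algebra algC.
Set Implicit Arguments. Unset Strict Implicit. Unset Printing Implicit Defensive.
Import Order.TTheory GRing.Theory Num.Theory.
Local Open Scope ring_scope.

Definition simple_graph (T : finType) (e : rel T) : Prop :=
  symmetric e /\ irreflexive e.

Definition connected_graph (T : finType) (e : rel T) : Prop :=
  forall x y : T, connect e x y.

Definition independent (T : finType) (e : rel T) (A : {set T}) : bool :=
  [forall x in A, forall y in A, ~~ e x y].

Definition alpha (T : finType) (e : rel T) : nat :=
  \max_(A : {set T} | independent e A) #|A|.

Definition degree (T : finType) (e : rel T) (x : T) : nat := #|[set y | e x y]|.

Definition laplacian (T : finType) (e : rel T) : 'M[algC]_#|T| :=
  \matrix_(i, j) (if i == j then (degree e (enum_val i))%:R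
                  else - ((e (enum_val i) (enum_val j))%:R)).

(* the Laplacian eigenvalues with multiplicity: the roots (with multiplicity)
   of the characteristic polynomial, which splits over algC *)
Definition lap_spectrum (T : finType) (e : rel T) : seq algC :=
  sval (closed_field_poly_normal (char_poly (laplacian e))).

Definition mG_closed (T : finType) (e : rel T) (a b : algC) : nat :=
  count (fun x => (a <= x) && (x <= b)) (lap_spectrum e).

(* Binary star graphs on 'I_(p+q+r+2):
   u = 0, v = 1, w_i = 2 .. q+1, u_j = q+2 .. q+p+1, v_k = q+p+2 .. p+q+r+1.
   uv = true adds the edge uv (giving B'). *)
Definition bs_adj0 (p q r : nat) (uv : bool) (x y : nat) : bool :=
  let isW k := (2 <= k < q + 2)%N in
  let isU k := (q + 2 <= k < q + p + 2)%N in
  let isV k := (q + p + 2 <= k < p + q + r + 2)%N in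
  [|| (x == 0)%N && (isW y || isU y),
      (x == 1)%N && (isW y || isV y)
    | [&& uv, x == 0 & y == 1]%N].

Definition bstar (p q r : nat) (uv : bool) : rel 'I_(p + q + r + 2) :=
  fun x y => bs_adj0 p q r uv x y || bs_adj0 p q r uv y x.

Definition isomorphic (T T' : finType) (e : rel T) (e' : rel T') : Prop :=
  exists f : T -> T', bijective f /\ forall x y, e x y = e' (f x) (f y).
Arguments bstar : clear implicits.

(* Main.v *)
(** The number of Laplacian eigenvalues greater than 2 is read off the Hermitian
    form [E f = sum over edges xy of |f x - f y|^2] compared with [2 |f|^2].
    The complement [{u, v}] of a maximum independent set covers all edges, so
    [E f <= 2 |f|^2] on the codimension-2 space [f u = f v = 0]: at most two
    eigenvalues exceed 2, and [m_G[0,2] = n - 2] means that exactly two do.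

    On functions equal to [- f u] (resp. [- f v]) on the leaves and to
    [-2 (f u + f v)] on the common neighbours, [E f - 2 |f|^2] is a binary form
    in [f u, f v], positive definite for each of the three families.  In the
    remaining connected graphs with [alpha = n - 2], namely P4 and C4, the form
    is nonpositive on a hyperplane [f u = f v] or [f u = - f v], so only one
    eigenvalue exceeds 2. *)
Require Import Defs.
From HB Require Import structures.
From mathcomp Require Import all_boot all_order all_algebra algC.
From mathcomp Require Import ring zify.
Set Implicit Arguments. Unset Strict Implicit. Unset Printing Implicit Defensive.
Import Order.TTheory GRing.Theory Num.Theory.
Local Open Scope ring_scope.
Local Open Scope sesquilinear_scope.

(** * Hermitian forms and counting of eigenvalues above a threshold *)

Lemma exists_row_kernel (F : fieldType) k m (X : 'M[F]_(k, m)) :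
  (m < k)%N -> exists2 a : 'rV_k, a != 0 & a *m X = 0.
Proof.
move=> lt_mk; have: kermx X != 0.
  rewrite kermx_eq0 /row_free neq_ltn.
  by rewrite (leq_ltn_trans (rank_leq_col X) lt_mk).
case/rowV0Pn => a aK a0; exists a => //; exact/sub_kermxP.
Qed.

Definition qform n (A : 'M[algC]_n) (v : 'rV_n) : algC :=
  (v *m A *m v ^t*) 0 0.

Lemma spectral_unitaryE n (A : 'M[algC]_n) : A \is normalmx ->
  A = (spectralmx A) ^t* *m diag_mx (spectral_diag A) *m spectralmx A.
Proof.
move=> /orthomx_spectralP {1}->.
by rewrite invmx_unitary ?spectral_unitarymx.
Qed.

Lemma qform_diag n (d b : 'rV[algC]_n) :
  qform (diag_mx d) b = \sum_i d 0 i * `|b 0 i| ^+ 2.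
Proof.
rewrite /qform mxE; apply: eq_bigr => i _.
rewrite mul_mx_diag !mxE normCK; ring.
Qed.

Lemma qform_spectral n (A : 'M[algC]_n) (b : 'rV_n) : A \is normalmx ->
  qform A (b *m spectralmx A) = \sum_i spectral_diag A 0 i * `|b 0 i| ^+ 2.
Proof.
move=> nA; rewrite -qform_diag /qform {2}(spectral_unitaryE nA).
have /unitarymxP U := spectral_unitarymx A.
rewrite trmx_mul map_mxM /= !mulmxA -(mulmxA b) U mulmx1.
by rewrite -(mulmxA _ _ (spectralmx A ^t*)) U mulmx1.
Qed.

Lemma qform1_spectral n (A : 'M[algC]_n) (b : 'rV_n) :
  qform 1%:M (b *m spectralmx A) = \sum_i `|b 0 i| ^+ 2.
Proof.
transitivity (qform (diag_mx (const_mx 1)) b).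
  rewrite /qform diag_const_mx !mulmx1 trmx_mul map_mxM /= !mulmxA.
  by rewrite -(mulmxA b) (unitarymxP (spectral_unitarymx A)) mulmx1.
by rewrite qform_diag; apply: eq_bigr => i _; rewrite mxE mul1r.
Qed.

Lemma spectralmx_mulKV n (A : 'M[algC]_n) (v : 'rV_n) :
  v *m (spectralmx A) ^t* *m spectralmx A = v.
Proof.
by rewrite -(invmx_unitary (spectral_unitarymx A)) mulmxKV ?spectral_unit.
Qed.

(** Similar matrices share their characteristic polynomial, and for a diagonal matrix it splits with
    the diagonal entries as roots; unique factorisation then matches the two multisets. *)
Lemma perm_roots_spectral n (A : 'M[algC]_n) (s : seq algC) :
  A \is normalmx -> char_poly A = \prod_(z <- s) ('X - z%:P) ->
  perm_eq s [seq spectral_diag A 0 i | i <- enum 'I_n].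
Proof.
move=> nA eA; apply: prod_XsubC_eq; rewrite -eA big_map big_enum /=.
have: char_poly A = char_poly (diag_mx (spectral_diag A)).
  pose P := map_mx polyC (spectralmx A).
  have uP : P \in unitmx by rewrite map_unitmx spectral_unit.
  rewrite /char_poly.
  have -> : char_poly_mx A
      = invmx P *m char_poly_mx (diag_mx (spectral_diag A)) *m P.
    rewrite /char_poly_mx mulmxBr mulmxBl -scalemx1 -scalemxAr -scalemxAl.
    rewrite mulmx1 mulVmx // scalemx1; congr (_ - _).
    rewrite /P -map_invmx -!map_mxM /=; congr map_mx.
    by move/orthomx_spectralP: nA.
  by rewrite -mulmxA det_mulmx mulrC -det_mulmx -mulmxA mulmxV // mulmx1.
move=> ->; rewrite char_poly_trig ?diag_mx_is_trig //.
by apply: eq_bigr => i _; rewrite mxE eqxx mulr1n.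
Qed.

Lemma qform_ge0_spectral n (A : 'M[algC]_n) : A \is normalmx ->
  (forall v, 0 <= qform A v) -> forall i, 0 <= spectral_diag A 0 i.
Proof.
move=> nA A_ge0 i; have := A_ge0 (delta_mx 0 i *m spectralmx A).
rewrite qform_spectral // (bigD1 i) //= big1 => [|j ji].
  by rewrite mxE !eqxx normr1 expr1n mulr1 addr0.
by rewrite mxE (negPf ji) andbF normr0 expr0n mulr0.
Qed.

(** Nonnegativity of the form makes every eigenvalue nonnegative, hence real, so [x <= c] and
    [c < x] are complementary although the order of [algC] is partial. *)
Lemma count_roots_spectral n (A : 'M[algC]_n) (c : algC) (s : seq algC) :
  A \is normalmx -> (forall v, 0 <= qform A v) -> 0 <= c ->
  char_poly A = \prod_(z <- s) ('X - z%:P) ->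
  (count (fun x => (0 <= x) && (x <= c))%R s
     + #|[set i | (c < spectral_diag A 0 i)%R]|)%N = n.
Proof.
move=> nA A_ge0 c_ge0 /(perm_roots_spectral nA)/permP->.
rewrite count_map -[RHS]card_ord -(cardC [set i | (c < spectral_diag A 0 i)%R]).
rewrite addnC; congr addn; rewrite cardE size_filter enumT.
apply: eq_count => i.
rewrite !inE /= qform_ge0_spectral //=.
by rewrite real_leNgt ?ger0_real // qform_ge0_spectral.
Qed.

(** With fewer than [k] eigenvalues above [c], some nonzero combination of the rows of [M] would
    have no component along their eigenvectors, and the form there would be at most [c] times the
    squared norm. *)
Lemma card_spectral_gt_ge n (A : 'M[algC]_n) (c : algC) k (M : 'M_(k, n)) :
  A \is normalmx -> (forall v, 0 <= qform A v) -> 0 <= c ->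
  (forall a, a != 0 -> c * qform 1%:M (a *m M) < qform A (a *m M)) ->
  (k <= #|[set i | (c < spectral_diag A 0 i)%R]|)%N.
Proof.
move=> nA A_ge0 c_ge0 M_gt; set J := [set i | _]; rewrite leqNgt; apply/negP.
pose X := colsub (@enum_val _ (mem J)) (M *m (spectralmx A) ^t*).
move=> /(exists_row_kernel X)[a a0 aX]; move: (M_gt a a0).
rewrite -(spectralmx_mulKV A (a *m M)); set b := _ *m _ ^t*.
rewrite qform_spectral // qform1_spectral mulr_sumr; apply/negP.
suff: \sum_i spectral_diag A 0 i * `|b 0 i| ^+ 2 <= \sum_i c * `|b 0 i| ^+ 2.
  by move=> le_dc; rewrite le_gtF.
apply: ler_sum => i _; have [iJ|] := boolP (i \in J); last first.
  rewrite inE -real_leNgt ?ger0_real // ?qform_ge0_spectral // => ?.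
  by rewrite ler_wpM2r ?exprn_ge0.
suff bi : b 0 i = 0 by rewrite bi normr0 expr0n !mulr0.
transitivity ((a *m X) 0 (enum_rank_in iJ i)); last by rewrite aX mxE.
by rewrite /X mulmx_colsub mulmxA [RHS]mxE enum_rankK_in.
Qed.

(** Dual dimension count: more than [k] eigenvectors with eigenvalue above [c] would span a space
    meeting the kernel of [N] nontrivially, where the form would exceed [c] times the squared
    norm. *)
Lemma card_spectral_gt_le n (A : 'M[algC]_n) (c : algC) k (N : 'M_(n, k)) :
  A \is normalmx ->
  (forall v, v *m N = 0 -> qform A v <= c * qform 1%:M v) ->
  (#|[set i | (c < spectral_diag A 0 i)%R]| <= k)%N.
Proof.
move=> nA N_le; set J := [set i | _]; rewrite leqNgt; apply/negP.
pose E : 'M[algC]_(#|J|, n) := \matrix_(i, j) (enum_val i == j)%:R.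
move=> /(exists_row_kernel (E *m spectralmx A *m N))[a a0].
rewrite !mulmxA => /N_le; rewrite qform_spectral // qform1_spectral mulr_sumr.
apply/negP; set b := a *m E.
have bE i : b 0 (enum_val i) = a 0 i.
  rewrite mxE (bigD1 i) //= mxE eqxx mulr1 big1 ?addr0 // => j ji.
  by rewrite mxE (inj_eq enum_val_inj) (negPf ji) mulr0.
have b0 i : i \notin J -> b 0 i = 0.
  move=> iJ; rewrite mxE big1 // => j _; rewrite mxE.
  case: eqP => [e|]; rewrite ?mulr0 //.
  by move: iJ; rewrite -e enum_valP.
have term_ge0 i : 0 <= (spectral_diag A 0 i - c) * `|b 0 i| ^+ 2.
  have [|/b0->] := boolP (i \in J); last by rewrite normr0 expr0n mulr0.
  by rewrite inE => /ltW ?; rewrite mulr_ge0 ?subr_ge0 ?exprn_ge0.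
have /rV0Pn[j aj] := a0.
suff lt: \sum_i c * `|b 0 i| ^+ 2
         < \sum_i spectral_diag A 0 i * `|b 0 i| ^+ 2 by rewrite lt_geF.
rewrite -subr_gt0 -sumrB (bigD1 (enum_val j)) //=.
under eq_bigr do rewrite -mulrBl.
rewrite ltr_wpDr ?sumr_ge0 // -mulrBl mulr_gt0 //.
  by have := enum_valP j; rewrite inE subr_gt0.
by rewrite bE exprn_gt0 // normr_gt0.
Qed.

(** * The Laplacian quadratic form of a graph *)

(* The sum ranges over ordered pairs, so this is twice the Laplacian form. *)
Definition energy (T : finType) (e : rel T) (f : T -> algC) : algC :=
  \sum_x \sum_y (e x y)%:R * `|f x - f y| ^+ 2.

Definition gt2_count (T : finType) (e : rel T) : nat :=
  #|[set i | (2%:R < spectral_diag (laplacian e) 0 i)%R]|.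

Section LaplacianForm.
Variables (T : finType) (e : rel T).
Hypotheses (e_sym : symmetric e) (e_irr : irreflexive e).
Implicit Types f : T -> algC.

Definition rowf f : 'rV[algC]_#|T| := \row_i f (enum_val i).

Lemma rowfK (v : 'rV[algC]_#|T|) : rowf (fun x => v 0 (enum_rank x)) = v.
Proof. by apply/rowP => i; rewrite mxE enum_valK. Qed.

Lemma big_enum_val_T (F : T -> algC) :
  \sum_(i < #|T|) F (enum_val i) = \sum_x F x.
Proof. by rewrite (reindex _ (onW_bij _ (enum_val_bij T))). Qed.

Lemma qform1_rowf f : qform 1%:M (rowf f) = \sum_x `|f x| ^+ 2.
Proof.
rewrite /qform mulmx1 mxE -big_enum_val_T; apply: eq_bigr => i _.
by rewrite !mxE normCK.
Qed.

Lemma qform_laplacian f : qform (laplacian e) (rowf f) *+ 2 = energy e f.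
Proof.
have qE : qform (laplacian e) (rowf f)
    = \sum_x \sum_y (e x y)%:R * (`|f x| ^+ 2 - f x * (f y)^*).
  rewrite /qform -mulmxA mxE -big_enum_val_T; apply: eq_bigr => i _.
  set x := enum_val i; rewrite !mxE.
  under eq_bigr => j _ do rewrite !mxE.
  rewrite (bigD1 i) //= eqxx -/x.
  under eq_bigr => j ji do rewrite eq_sym (negPf ji).
  have degE : (degree e x)%:R = \sum_y (e x y)%:R :> algC.
    rewrite /degree -sum1_card natr_sum big_mkcond /=; apply: eq_bigr => y _.
    by rewrite inE; case: (e x y).
  rewrite -/x degE -[RHS]big_enum_val_T.
  under [RHS]eq_bigr => j _ do rewrite mulrBr.
  rewrite sumrB mulrDr; congr (_ + _).
    rewrite mulrCA mulr_suml -big_enum_val_T; apply: eq_bigr => j _.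
    by rewrite normCK.
  rewrite [in RHS](bigD1 i) //= -/x e_irr mul0r add0r mulr_sumr -sumrN.
  by apply: eq_bigr => j _; ring.
(* Adding the copy with [x] and [y] exchanged completes each term to [|f x - f y|^2]. *)
rewrite mulr2n {2}qE exchange_big qE /energy /= -big_split /=.
apply: eq_bigr => x _; rewrite -big_split /=; apply: eq_bigr => y _.
rewrite (e_sym y x) !normCK rmorphB; ring.
Qed.

Lemma energy_ge0 f : 0 <= energy e f.
Proof. by do 2![apply: sumr_ge0 => ? _]; rewrite mulr_ge0 ?exprn_ge0. Qed.

Lemma laplacian_normal : laplacian e \is normalmx.
Proof.
suff LE : (laplacian e) ^t* = laplacian e by apply/normalmxP; rewrite LE.
apply/matrixP => i j; rewrite !mxE eq_sym e_sym.
by case: eqP => [->|_]; rewrite ?rmorphN rmorph_nat.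
Qed.

Lemma qform_laplacian_ge0 v : 0 <= qform (laplacian e) v.
Proof.
by rewrite -(rowfK v) -(@pmulrn_lge0 _ _ 2) // qform_laplacian energy_ge0.
Qed.

Lemma mG_closed_0_2 : (mG_closed e 0%R 2%:R%R + gt2_count e)%N = #|T|.
Proof.
rewrite /mG_closed /gt2_count /lap_spectrum; case: closed_field_poly_normal.
move=> s /= sE; rewrite (monicP (char_poly_monic _)) scale1r in sE.
apply: count_roots_spectral => //; first exact: laplacian_normal.
exact: qform_laplacian_ge0.
Qed.

(** The factor 4 is the threshold 2 doubled, since [energy] is twice the form. *)
Lemma gt2_count_ge k (g : 'I_k -> T -> algC) :
  (forall a : 'rV_k, a != 0 -> let f x := \sum_i a 0 i * g i x in
     4%:R * \sum_x `|f x| ^+ 2 < energy e f) ->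
  (k <= gt2_count e)%N.
Proof.
move=> g_gt; pose M : 'M[algC]_(k, #|T|) := \matrix_(i, j) g i (enum_val j).
apply: (@card_spectral_gt_ge _ _ _ _ M) => //.
- exact: laplacian_normal.
- exact: qform_laplacian_ge0.
move=> a /g_gt; pose f x := \sum_i a 0 i * g i x; rewrite -/f /=.
have -> : a *m M = rowf f.
  by apply/rowP => i; rewrite !mxE; apply: eq_bigr => j _; rewrite mxE.
rewrite qform1_rowf -qform_laplacian; set Q := qform _ _; set S := \sum_x _.
have -> : 4%:R * S = (2%:R * S) *+ 2 by ring.
by rewrite ltr_pMn2r.
Qed.

Lemma gt2_count_le k (w : 'I_k -> T -> algC) :
  (forall f, (forall i, \sum_x f x * w i x = 0) ->
     energy e f <= 4%:R * \sum_x `|f x| ^+ 2) ->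
  (gt2_count e <= k)%N.
Proof.
move=> w_le; pose N : 'M[algC]_(#|T|, k) := \matrix_(i, j) w j (enum_val i).
apply: (@card_spectral_gt_le _ _ _ _ N); first exact: laplacian_normal.
move=> v; rewrite -(rowfK v); pose f x := v 0 (enum_rank x).
rewrite -/f => /rowP vN.
have /w_le : forall i, \sum_x f x * w i x = 0.
  move=> i; apply: etrans (etrans (vN i) _); rewrite !mxE // -big_enum_val_T.
  by apply: eq_bigr => j _; rewrite !mxE.
rewrite qform1_rowf -qform_laplacian; set S := \sum_x _.
have -> : 4%:R * S = (2%:R * S) *+ 2 by ring.
by rewrite ler_pMn2r.
Qed.

End LaplacianForm.

(** * Graphs covered by two vertices, and upper bounds *)

Definition covering_pair (T : finType) (e : rel T) (u v : T) : Prop :=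
  u != v /\ forall x y, e x y -> [|| x == u, x == v, y == u | y == v].

(** For a covering pair, a member has [u] as its only neighbour. Swapping the arguments gives the
    leaves at [v]. *)
Definition leaves (T : finType) (e : rel T) (u v : T) : {set T} :=
  [set x | [&& x != u, x != v, e x u & ~~ e x v]].

Definition common_neighbors (T : finType) (e : rel T) (u v : T) : {set T} :=
  [set x | [&& x != u, x != v, e x u & e x v]].

Lemma big_rem2 (T : finType) (u v : T) (F : T -> algC) : u != v ->
  \sum_x F x = F u + F v + \sum_(x | (x != u) && (x != v)) F x.
Proof.
move=> uv; rewrite (bigD1 u) //= (bigD1 v) /=; last by rewrite eq_sym.
by rewrite addrA.
Qed.

Section Cover.
Variables (T : finType) (e : rel T) (u v : T).
Hypotheses (e_sym : symmetric e) (e_irr : irreflexive e).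
Hypothesis uv_cover : covering_pair e u v.
Implicit Types f : T -> algC.

(** The Laplacian form minus twice the squared norm, arranged so that each vertex outside the pair
    contributes its own separate term. *)
Definition excess f : algC :=
  (e u v)%:R * `|f u - f v| ^+ 2 - 2%:R * `|f u| ^+ 2 - 2%:R * `|f v| ^+ 2
  + \sum_(x | (x != u) && (x != v))
      ((e x u)%:R * `|f x - f u| ^+ 2 + (e x v)%:R * `|f x - f v| ^+ 2
       - 2%:R * `|f x| ^+ 2).

Lemma eq_excess f g : f =1 g -> excess f = excess g.
Proof.
move=> fg; rewrite /excess !fg; congr (_ + _).
by apply: eq_bigr => x _; rewrite !fg.
Qed.

Lemma energy_excess f :
  energy e f - 4%:R * (\sum_x `|f x| ^+ 2) = 2%:R * excess f.
Proof.
have [uv cov] := uv_cover.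
pose h x y : algC := (e x y)%:R * `|f x - f y| ^+ 2.
have hC x y : h x y = h y x by rewrite /h e_sym distrC.
have h0 x : h x x = 0 by rewrite /h e_irr mul0r.
have rowE x : (x != u) && (x != v) -> \sum_y h x y = h x u + h x v.
  move=> /andP[xu xv]; rewrite (big_rem2 _ uv) big1 ?addr0 // => y /andP[yu yv].
  rewrite /h; case exy: (e x y); last by rewrite mul0r.
  by have := cov _ _ exy; rewrite (negPf xu) (negPf xv) (negPf yu) (negPf yv).
have colE z : \sum_(y | (y != u) && (y != v)) h z y
    = \sum_(y | (y != u) && (y != v)) h y z by apply: eq_bigr => y _.
have -> : energy e f = \sum_x \sum_y h x y by [].
rewrite (big_rem2 _ uv) (eq_bigr _ rowE) !(big_rem2 _ uv) !h0 (hC v u) !colE.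
rewrite /excess sumrB !big_split /= -/(h u v) -mulr_sumr /h; ring.
Qed.

Lemma energy_le f :
  (energy e f <= 4%:R * (\sum_x `|f x| ^+ 2)) = (excess f <= 0).
Proof.
by rewrite -subr_le0 energy_excess pmulr_rle0 // ltr0n.
Qed.

Lemma energy_gt f :
  (4%:R * (\sum_x `|f x| ^+ 2) < energy e f) = (0 < excess f).
Proof.
by rewrite -subr_gt0 energy_excess pmulr_rgt0 // ltr0n.
Qed.

Lemma sum_indicator f x : \sum_y f y * (y == x)%:R = f x.
Proof.
rewrite (bigD1 x) //= eqxx mulr1 big1 ?addr0 // => y /negPf->.
by rewrite mulr0.
Qed.

(** When [f] vanishes at [u] and [v], any other vertex [x] contributes [(deg x - 2) |f x|^2], and
    its neighbours lie in the pair, so [deg x <= 2]. *)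
Lemma gt2_count_le2 : (gt2_count e <= 2)%N.
Proof.
apply: (@gt2_count_le _ _ e_sym e_irr 2
  (fun i y => (y == if i == ord0 then u else v)%:R)) => f f0.
have fu : f u = 0 by have := f0 ord0; rewrite sum_indicator.
have fv : f v = 0 by have := f0 ord_max; rewrite sum_indicator.
rewrite energy_le /excess fu fv !subr0 normr0 expr0n /= !mulr0 !subr0 add0r.
apply: sumr_le0 => x _; rewrite !subr0 -mulrDl -mulrBl.
rewrite mulr_le0_ge0 ?exprn_ge0 // subr_le0 -natrD ler_nat.
by case: (e x u); case: (e x v).
Qed.

(* On the hyperplane [f u = c * f v] with [c = 1] or [c = -1], each of the
   other two vertices contributes at most [2 |f u|^2] to the excess. *)
Lemma gt2_count_le1 (c : algC) : c ^+ 2 = 1 -> c^* = c -> #|T| = 4 ->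
  (e u v -> c = 1) -> (common_neighbors e u v != set0 -> c = -1) ->
  (gt2_count e <= 1)%N.
Proof.
move=> c2 cC T4 uvc Wc; have [uv cov] := uv_cover.
apply: (@gt2_count_le _ _ e_sym e_irr 1
  (fun _ y => (y == u)%:R - c * (y == v)%:R)) => f /(_ ord0) f0.
have {f0} fu : f u = c * f v.
  apply/eqP; rewrite -subr_eq0 -{}f0; apply/eqP.
  under [in RHS]eq_bigr => y _ do rewrite mulrBr mulrCA.
  by rewrite sumrB -mulr_sumr !sum_indicator.
have nE : `|f u| ^+ 2 = `|f v| ^+ 2.
  by rewrite fu !normCK rmorphM /= cC mulrACA -expr2 c2 mul1r.
rewrite energy_le /excess -nE.
(* If [u] and [v] are adjacent then [c = 1], hence [f u = f v]. *)
have -> : (e u v)%:R * `|f u - f v| ^+ 2 = 0.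
  case: (e u v) uvc => [/(_ isT) c1|_]; last by rewrite mul0r.
  by rewrite fu c1 mul1r subrr normr0 expr0n mulr0.
have cI : #|[pred x | (x != u) && (x != v)]| = 2.
  have := cardC [pred x | (x != u) && (x != v)]; rewrite T4.
  rewrite (@eq_card _ [predC _] (mem [set u; v])) => [|x]; last first.
    by rewrite !inE -negb_or negbK.
  by rewrite cards2 uv => /eqP; rewrite (eqn_add2r 2 _ 2) => /eqP.
have: \sum_(x | (x != u) && (x != v))
      ((e x u)%:R * `|f x - f u| ^+ 2 + (e x v)%:R * `|f x - f v| ^+ 2
       - 2%:R * `|f x| ^+ 2) 
    <= \sum_(x in [pred x | (x != u) && (x != v)]) 2%:R * `|f u| ^+ 2.
  apply: ler_sum => x /andP[xu xv].
  case exu: (e x u); case exv: (e x v); rewrite ?mul1r ?mul0r ?add0r ?addr0.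
  (* At a common neighbour [f v = - f u], and the parallelogram law gives exactly [2 |f u|^2]. In
     the two leaf cases below the deficit is a square. *)
  - have {}c1 : c = -1.
      by apply: Wc; apply/set0Pn; exists x; rewrite inE xu xv exu exv.
    have -> : f v = - f u by rewrite fu c1 mulN1r opprK.
    rewrite le_eqVlt; apply/orP; left; apply/eqP.
    by rewrite !normCK !rmorphB rmorphN; ring.
  - rewrite -subr_ge0.
    have -> : 2%:R * `|f u| ^+ 2 - (`|f x - f u| ^+ 2 - 2%:R * `|f x| ^+ 2)
      = `|f x + f u| ^+ 2 by rewrite !normCK rmorphB rmorphD; ring.
    exact: exprn_ge0.
  - rewrite nE -subr_ge0.
    have -> : 2%:R * `|f v| ^+ 2 - (`|f x - f v| ^+ 2 - 2%:R * `|f x| ^+ 2)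
      = `|f x + f v| ^+ 2 by rewrite !normCK rmorphB rmorphD; ring.
    exact: exprn_ge0.
  - by rewrite (@le_trans _ _ 0) ?oppr_le0 ?mulr_ge0 ?exprn_ge0.
(* Two such vertices contribute at most [4 |f u|^2], which the negative terms at [u] and [v]
   cancel. *)
rewrite sumr_const cI add0r => le2; rewrite -opprD addrC subr_le0.
by apply: le_trans le2 _; rewrite mulr2n.
Qed.

End Cover.

(** * A two-dimensional test space for the lower bound *)

Lemma quad_form_gt0 (X Y Z : int) (a b : algC) :
  0 < X -> Y * Y < X * Z -> (a != 0) || (b != 0) ->
  0 < X%:~R * `|a| ^+ 2 + Y%:~R * (a * b^* + a^* * b) + Z%:~R * `|b| ^+ 2.
Proof.
move=> X0 disc ab; have XC : (0 : algC) < X%:~R by rewrite ltr0z.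
(* Multiplying by [X] allows completing the square without division. *)
rewrite -(pmulr_rgt0 _ XC).
have -> : X%:~R * (X%:~R * `|a| ^+ 2 + Y%:~R * (a * b^* + a^* * b)
                   + Z%:~R * `|b| ^+ 2)
  = `|X%:~R * a + Y%:~R * b| ^+ 2 + (X * Z - Y * Y)%:~R * `|b| ^+ 2.
  rewrite !normCK rmorphD !rmorphM !rmorph_int rmorphB !rmorphM /=; ring.
have [b0|b0] := eqVneq b 0.
  move: ab; rewrite b0 eqxx orbF => a0.
  rewrite mulr0 addr0 normr0 expr0n mulr0 addr0 exprn_gt0 // normr_gt0.
  by rewrite mulf_neq0 // gt_eqF.
rewrite ltr_wpDl ?exprn_ge0 // mulr_gt0 ?exprn_gt0 ?normr_gt0 //.
by rewrite ltr0z subr_gt0.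
Qed.

Section TestSpace.
Variables (T : finType) (e : rel T) (u v : T).
Hypotheses (e_sym : symmetric e) (e_irr : irreflexive e).
Hypothesis uv_cover : covering_pair e u v.

Let p := #|leaves e u v|.
Let q := #|common_neighbors e u v|.
Let r := #|leaves e v u|.
Let E : nat := e u v.

(* Leaves are given the opposite of their neighbour's value, which maximises
   their excess; a common neighbour has excess linear in its value, and
   [-2 (f u + f v)] is already far enough. *)
Definition test_value (x y z : T) : algC :=
  if z == x then 1 else if z == y then 0 else
  if e z x then (if e z y then - 2%:R else -1) else 0.

Lemma excess_test (a b : algC) :
  excess e u v (fun z => a * test_value u v z + b * test_value v u z)
  = (2 * p%:Z + 5 * q%:Z + E%:Z - 2)%:~R * `|a| ^+ 2
    + (4 * q%:Z - E%:Z)%:~R * (a * b^* + a^* * b)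
    + (2 * r%:Z + 5 * q%:Z + E%:Z - 2)%:~R * `|b| ^+ 2.
Proof.
have [uv _] := uv_cover.
pose f z := a * test_value u v z + b * test_value v u z.
rewrite -/f /excess.
have fu : f u = a by rewrite /f /test_value eqxx (negPf uv); ring.
have fv : f v = b by rewrite /f /test_value eqxx eq_sym (negPf uv); ring.
rewrite fu fv.
(* A leaf with value [-a] gives [|2a|^2 - 2|a|^2]. At a common neighbour the value [t = -2(a + b)]
   gives [|t - a|^2 + |t - b|^2 - 2|t|^2 = |a|^2 + |b|^2 + 4|a + b|^2]. *)
pose D x := (x \in leaves e u v)%:R * (2%:R * `|a| ^+ 2)
  + (x \in common_neighbors e u v)%:R
      * (`|a| ^+ 2 + `|b| ^+ 2 + 4%:R * `|a + b| ^+ 2)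
  + (x \in leaves e v u)%:R * (2%:R * `|b| ^+ 2).
rewrite (eq_bigr D) => [|x /andP[xu xv]]; last first.
  rewrite /D !inE xu xv /= /f /test_value (negPf xu) (negPf xv).
  case: (e x u); case: (e x v); rewrite /= !normCK 
    ?(rmorphD,rmorphM,rmorphN,rmorphB,rmorph1,rmorph0,rmorph_nat) /=; ring.
have cardE (A : {set T}) : {in A, forall x, (x != u) && (x != v)} ->
    \sum_(x | (x != u) && (x != v)) (x \in A)%:R = #|A|%:R :> algC.
  move=> AI; rewrite -sum1_card natr_sum [RHS]big_mkcond [LHS]big_mkcond /=.
  apply: eq_bigr => x _; case xA: (x \in A); last by case: ifP.
  by rewrite AI.
rewrite /D !big_split /= -!mulr_suml !cardE; first last.
- by move=> x; rewrite inE => /and4P[-> ->].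
- by move=> x; rewrite inE => /and4P[-> ->].
- by move=> x; rewrite inE => /and4P[-> ->].
rewrite -/p -/q -/r -/E !normCK.
rewrite !(rmorphD,rmorphB,rmorphM) /=; ring.
Qed.

(** The hypotheses are Sylvester's criterion for the binary form of [excess_test]: positive leading
    coefficient and positive determinant. *)
Lemma gt2_count_ge2 :
  (0 < 2 * p%:Z + 5 * q%:Z + E%:Z - 2) ->
  ((4 * q%:Z - E%:Z) * (4 * q%:Z - E%:Z) <
    (2 * p%:Z + 5 * q%:Z + E%:Z - 2) * (2 * r%:Z + 5 * q%:Z + E%:Z - 2)) ->
  (2 <= gt2_count e)%N.
Proof.
move=> X0 disc.
apply: (@gt2_count_ge _ _ e_sym e_irr 2
  (fun i => if i == ord0 then test_value u v else test_value v u)) => a a0.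
move=> /=; rewrite (energy_gt e_sym e_irr uv_cover).
rewrite (eq_excess e u v (g := fun z =>
  a 0 0 * test_value u v z + a 0 1 * test_value v u z)) => [|x]; last first.
  rewrite !big_ord_recl big_ord0 addr0 /=; congr (_ + a 0 _ * _).
  exact: val_inj.
rewrite excess_test; apply: quad_form_gt0 => //.
apply: contraR a0; rewrite negb_or !negbK => /andP[/eqP a00 /eqP a01].
apply/eqP/rowP => i; rewrite mxE.
have [->|->] : i = 0 \/ i = 1; rewrite ?a00 ?a01 //.
by case: i => -[|[|//]] ?; [left|right]; apply: val_inj.
Qed.

End TestSpace.

(** * Binary stars as labelled graphs with a covering pair *)

Section Labelling.
Variables (T : finType) (e : rel T) (u v : T).
Hypotheses (e_sym : symmetric e) (e_irr : irreflexive e).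

(** Natural-number labels keep adjacency in the arithmetic form of [bs_adj0]; the cardinality
    equation turns injectivity into bijectivity. *)
Definition star_labelling (p q r : nat) (uv : bool) (l : T -> nat) : Prop :=
  [/\ injective l, forall x, (l x < p + q + r + 2)%N,
      #|T| = (p + q + r + 2)%N &
      forall x y, e x y = bs_adj0 p q r uv (l x) (l y)
                          || bs_adj0 p q r uv (l y) (l x)].

Lemma isomorphic_bstarP p q r uv :
  isomorphic e (bstar p q r uv) <-> exists l, star_labelling p q r uv l.
Proof.
split=> [[f [f_bij fE]]|[l [l_inj l_lt cT lE]]].
  exists (fun x => val (f x)); split=> //.
  - by move=> x y /val_inj /(bij_inj f_bij).
  - by move=> x; exact: ltn_ord.
  - by rewrite (bij_eq_card f_bij) card_ord.
exists (fun x => Ordinal (l_lt x)); split=> //.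
by apply: inj_card_bij => [x y [/l_inj]|] //; rewrite card_ord cT.
Qed.

Lemma labelling_of_cover : covering_pair e u v ->
  (forall x, x != u -> x != v -> e x u || e x v) ->
  exists l, star_labelling #|leaves e u v| #|common_neighbors e u v|
              #|leaves e v u| (e u v) l.
Proof.
move=> [uv cov] dom.
set P := leaves e u v; set W := common_neighbors e u v; set R := leaves e v u.
(* This is the vertex order used by [bs_adj0]; the label of a vertex will be its position here. *)
pose s := [:: u, v & enum W ++ enum P ++ enum R].
have s_mem x : x \in s.
  rewrite !inE !mem_cat !mem_enum !inE.
  have [//|xu] := eqVneq x u; have [//|xv] /= := eqVneq x v.
  by move: (dom _ xu xv); case: (e x u); case: (e x v).
have s_uniq : uniq s.
  rewrite /= inE negb_or uv !mem_cat !mem_enum !inE !eqxx !andbF /=.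
  rewrite !cat_uniq !enum_uniq andbT /=; apply/andP; split.
    apply/hasPn => x; rewrite mem_cat !mem_enum !inE.
    by case/orP => /and4P[-> -> /= -> /negPf->]; rewrite ?andbF.
  apply/hasPn => x; rewrite !mem_enum !inE.
  by case/and4P => -> -> /= -> /negPf->.
have s_size : size s = (#|P| + #|W| + #|R| + 2)%N.
  by rewrite /= !size_cat -!cardE addn2 addnCA addnA.
have cT : #|T| = (#|P| + #|W| + #|R| + 2)%N.
  rewrite -s_size -(card_uniqP s_uniq); apply: eq_card => x.
  by rewrite s_mem.
pose l x := index x s.
have idx (A : {set T}) x : x \in A -> (index x (enum A) < #|A|)%N.
  by move=> xA; rewrite cardE index_mem mem_enum.
have lE x : [\/ x = u /\ l x = 0%N, x = v /\ l x = 1%N,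
    [/\ x \in W, (2 <= l x)%N & (l x < #|W| + 2)%N]
  | [/\ x \in P, (#|W| + 2 <= l x)%N & (l x < #|W| + #|P| + 2)%N] \/
    [/\ x \in R, (#|W| + #|P| + 2 <= l x)%N
      & (l x < #|P| + #|W| + #|R| + 2)%N]].
  have [->|xu] := eqVneq x u; first by constructor 1; rewrite /l /= eqxx.
  have [->|xv] := eqVneq x v.
    by constructor 2; rewrite /l /= (negPf uv) eqxx.
  have lxE : l x = (if x \in W then index x (enum W) else
      #|W| + if x \in P then index x (enum P) else #|P| + index x (enum R)).+2.
    rewrite /l /= eq_sym (negPf xu) eq_sym (negPf xv) !index_cat !mem_enum.
    by rewrite -!cardE.
  rewrite lxE; case xW: (x \in W).
    by constructor 3; have := idx _ _ xW; split; lia.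
  case xP: (x \in P); constructor 4.
    by left; have := idx _ _ xP; split; lia.
  right; have xR : x \in R.
    move: xW xP (dom _ xu xv); rewrite !inE xu xv /=.
    by case: (e x u); case: (e x v).
  by have := idx _ _ xR; split; lia.
exists l; split=> //.
- by move=> x y; apply: index_inj.
- by move=> x; rewrite -s_size index_mem.
(* Conversely, the interval containing a label determines the class, so [bs_adj0] on labels becomes
   a Boolean formula in equality with, and adjacency to, [u] and [v]. *)
have l_class x : [/\ (l x == 0%N) = (x == u), (l x == 1%N) = (x == v),
    (2 <= l x < #|W| + 2)%N = (x \in W),
    (#|W| + 2 <= l x < #|W| + #|P| + 2)%N = (x \in P)
    & (#|W| + #|P| + 2 <= l x < #|P| + #|W| + #|R| + 2)%N = (x \in R)].
  have [[xE l0]|[xE l1]|[xW l_ge l_lt]|[[xP l_ge l_lt]|[xR l_ge l_lt]]] := lE x.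
  - by rewrite l0 xE !inE !eqxx (negPf uv) /=; split; lia.
  - by rewrite l1 xE !inE !eqxx (eq_sym v) (negPf uv) /=; split; lia.
  - move: (xW); rewrite !inE => /and4P[/negPf-> /negPf-> -> ->] /=; split; lia.
  - move: (xP); rewrite !inE => /and4P[/negPf-> /negPf-> -> /negPf->] /=.
    by split; lia.
  - move: (xR); rewrite !inE => /and4P[/negPf-> /negPf-> -> /negPf->] /=.
    by split; lia.
move=> x y; rewrite /bs_adj0.
have [-> -> -> -> ->] := l_class x; have [-> -> -> -> ->] := l_class y.
rewrite !inE; have := cov x y.
have [->|xu] := eqVneq x u; have [->|yu] := eqVneq y u;
  rewrite ?eqxx ?(negPf uv) ?(eq_sym v u) ?(negPf uv) ?e_irr //=.
all: have [xv|xv] := eqVneq x v; have [yv|yv] := eqVneq y v;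
  rewrite ?xv ?yv ?e_irr ?(e_sym u) ?(e_sym v) ?(negPf uv) ?eqxx //=.
all: rewrite ?(e_sym v u).
all: by case: (e x y); case: (e x u); case: (e x v); case: (e y u);
  case: (e y v); case: (e u v) => //= /(_ isT).
Qed.

Lemma cover_of_labelling p q r uv l : star_labelling p q r uv l ->
  exists x y, [/\ covering_pair e x y, #|leaves e x y| = p,
    #|common_neighbors e x y| = q, #|leaves e y x| = r & e x y = uv].
Proof.
move=> [l_inj l_lt cT lE].
pose f x : 'I_(p + q + r + 2) := Ordinal (l_lt x).
have f_bij : bijective f.
  by apply: inj_card_bij => [x y [/l_inj]|] //; rewrite card_ord cT.
have [g fK gK] := f_bij.
have lg i : l (g i) = i by have := congr1 val (gK i).
have n0 : (0 < p + q + r + 2)%N by lia.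
have n1 : (1 < p + q + r + 2)%N by lia.
pose x0 := g (Ordinal n0); pose y0 := g (Ordinal n1).
have lx0 : l x0 = 0%N by rewrite lg.
have ly0 : l y0 = 1%N by rewrite lg.
have eqx0 x : (x == x0) = (l x == 0%N) by rewrite -(inj_eq l_inj) lx0.
have eqy0 x : (x == y0) = (l x == 1%N) by rewrite -(inj_eq l_inj) ly0.
(* The three vertex classes are preimages of label intervals, and bijectivity reduces their sizes to
   interval lengths. *)
have card_range a b (A : {set T}) : (b <= p + q + r + 2)%N ->
    (forall x, (x \in A) = (a <= l x < b)%N) -> #|A| = (b - a)%N.
  move=> b_le AE.
  rewrite -(card_imset _ (bij_inj f_bij)).
  transitivity (size (iota a (b - a))); last by rewrite size_iota.
  rewrite cardE -(size_map val); apply: perm_size; apply: uniq_perm.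
  - by rewrite (map_inj_uniq val_inj) enum_uniq.
  - exact: iota_uniq.
  move=> i; rewrite mem_iota; apply/mapP/idP => [[j]|i_in].
    by rewrite mem_enum => /imsetP[x + ->] ->; rewrite AE /=; lia.
  have i_lt : (i < p + q + r + 2)%N by lia.
  exists (Ordinal i_lt) => //; rewrite mem_enum -[Ordinal _]gK imset_f // AE lg /=.
  lia.
have lt x := l_lt x.
exists x0, y0; split.
- split; first by rewrite eqy0 lx0.
  move=> x y; rewrite lE !eqx0 !eqy0 /bs_adj0; lia.
- rewrite (@card_range (q + 2)%N (q + p + 2)%N); [lia|lia|].
  move=> x; rewrite inE eqx0 eqy0 !lE lx0 ly0 /bs_adj0.
  by have := lt x; case: uv {lE}; lia.
- rewrite (@card_range 2%N (q + 2)%N); [lia|lia|].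
  move=> x; rewrite inE eqx0 eqy0 !lE lx0 ly0 /bs_adj0.
  by have := lt x; case: uv {lE}; lia.
- rewrite (@card_range (q + p + 2)%N (p + q + r + 2)%N); [lia|lia|].
  move=> x; rewrite inE eqx0 eqy0 !lE lx0 ly0 /bs_adj0.
  by have := lt x; case: uv {lE}; lia.
- by rewrite lE lx0 ly0 /bs_adj0; case: uv {lE}; lia.
Qed.

End Labelling.

(** * Structure of connected graphs with independence number [n - 2] *)

Lemma independent_card_le (T : finType) (e : rel T) (A : {set T}) :
  independent e A -> (#|A| <= alpha e)%N.
Proof. by move=> iA; apply: (leq_bigmax_cond (F := fun B : {set T} => #|B|)). Qed.

Lemma exists_covering_pair (T : finType) (e : rel T) :
  (alpha e + 2)%N = #|T| -> exists u v, covering_pair e u v.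
Proof.
(* The empty set makes the range of the maximum nonempty, so the maximum is attained. *)
move=> eT; have i0 : independent e set0.
  by apply/forall_inP => x; rewrite inE.
have ind_gt0 : (0 < #|independent e|)%N by apply/card_gt0P; exists set0.
have [A iA aE] := eq_bigmax_cond (fun A : {set T} => #|A|) ind_gt0.
have /cards2P[u [v [uv AE]]] : #|~: A| == 2.
  by rewrite -(eqn_add2l #|A|) cardsC -eT -aE.
exists u, v; split=> // x y exy.
have Ax z : (z \in A) = ~~ ((z == u) || (z == v)).
  by rewrite -[A]setCK AE !inE.
have /forall_inP/(_ x)/[!Ax] := iA.
have [//|xu] := eqVneq x u; have [//|xv] /= := eqVneq x v.
move=> /(_ isT)/forall_inP/(_ y)/[!Ax].
by have [//|yu] := eqVneq y u; have [//|yv] /= := eqVneq y v;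
  rewrite exy => /(_ isT).
Qed.

Section ConnectedCover.
Variables (T : finType) (e : rel T) (u v : T).
Hypotheses (e_sym : symmetric e) (e_irr : irreflexive e).
Hypothesis e_conn : connected_graph e.
Hypothesis uv_cover : covering_pair e u v.

Lemma covering_pairC : covering_pair e v u.
Proof.
have [uv cov] := uv_cover; split; first by rewrite eq_sym.
move=> x y /cov; rewrite orbCA (orbC (y == u)); by case/or4P => ->; rewrite ?orbT.
Qed.

(** A path from [x] to [u] starts with an edge, whose other end must be [u] or [v]. *)
Lemma cover_dominates x : x != u -> x != v -> e x u || e x v.
Proof.
move=> xu xv; have [_ cov] := uv_cover.
have /connectP[[|y s] /= ] := e_conn x u; first by move=> _ ux; rewrite ux eqxx in xu.
case/andP => exy _ _; have := cov _ _ exy.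
by rewrite (negPf xu) (negPf xv) /= => /orP[] /eqP<-; rewrite exy ?orbT.
Qed.

(** Otherwise [u] together with its neighbours would be closed under adjacency and could not reach
    [v]. *)
Lemma common_neighbors_neq0 : ~~ e u v -> common_neighbors e u v != set0.
Proof.
move=> nuv; have [uv cov] := uv_cover; apply/negP => /eqP W0.
pose a := [pred x | (x == u) || e x u].
have a_closed : closed e a.
  apply: (intro_closed (sym_connect_sym e_sym)) => x y exy.
  rewrite !inE => /orP[/eqP xu|exu]; first by rewrite -xu e_sym exy orbT.
  have xu : x != u by apply: contraTneq exu => ->; rewrite e_irr.
  have xv : x != v by apply: contraTneq exu => ->; rewrite e_sym.
  have := cov _ _ exy; rewrite (negPf xu) (negPf xv) /= => /orP[->//|/eqP yv].
  have: x \in common_neighbors e u v by rewrite inE xu xv exu -yv.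
  by rewrite W0 inE.
have := closed_connect a_closed (e_conn u v).
by rewrite !inE eqxx e_sym (negPf nuv) eq_sym (negPf uv).
Qed.

(** If [v] had no leaf, only [u] could be adjacent to it, and the [n - 1] vertices other than [u]
    would be independent. *)
Lemma leaves_neq0 : (alpha e + 2)%N = #|T| ->
  common_neighbors e u v = set0 -> leaves e v u != set0.
Proof.
move=> eT W0; have [uv cov] := uv_cover; apply/negP => /eqP R0.
have nv x : x != u -> e x v = false.
  move=> xu; apply/negP => exv.
  have xv : x != v by apply: contraTneq exv => ->; rewrite e_irr.
  have: x \in common_neighbors e u v :|: leaves e v u.
    by rewrite !inE xu xv exv; case: (e x u).
  by rewrite W0 R0 !inE.
have iA : independent e [set~ u].
  apply/forall_inP => x; rewrite !inE => xu; apply/forall_inP => y.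
  rewrite !inE => yu; apply/negP => exy.
  have := cov _ _ exy; rewrite (negPf xu) (negPf yu) /= => /orP[]/eqP zv.
    by move: exy; rewrite zv e_sym nv.
  by move: exy; rewrite zv nv.
have := independent_card_le iA; have := cardsC [set u].
by rewrite cards1 -eT; lia.
Qed.

Lemma binary_star_of_gt2_count : (alpha e + 2)%N = #|T| ->
  (#|leaves e v u| <= #|leaves e u v|)%N -> gt2_count e = 2 ->
  exists p q r : nat, (r <= p)%N /\
     ( ([/\ (1 <= q)%N, (3 <= p + q + r)%N & isomorphic e (bstar p q r false)])
     \/ ([/\ q = 0%N, (2 <= p * r)%N & isomorphic e (bstar p q r true)])
     \/ ((1 <= q)%N /\ isomorphic e (bstar p q r true))).
Proof.
move=> eT le_rp e2; have [uv cov] := uv_cover.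
have [l lP] := labelling_of_cover e_sym e_irr uv_cover cover_dominates.
have iso := (isomorphic_bstarP e _ _ _ _).2 (ex_intro _ l lP).
have [_ _ cT _] := lP.
exists #|leaves e u v|, #|common_neighbors e u v|, #|leaves e v u|; split=> //.
case euv: (e u v) iso => iso.
  right; have [W0|W0] := eqVneq (common_neighbors e u v) set0; last first.
    by right; split=> //; rewrite card_gt0.
  left; have q0 : #|common_neighbors e u v| = 0%N by rewrite W0 cards0.
  split=> //; have := leaves_neq0 eT W0; rewrite -card_gt0 => r_gt0.
  have [le2|/negbTE gt2] := boolP (2 <= #|leaves e u v| * #|leaves e v u|)%N => //.
  (* Here [1 <= r <= p] and [p * r < 2] force [p = r = 1]: the path P4 with [u], [v] in the
     middle. *)
  have T4 : #|T| = 4 by nia.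
  have: (gt2_count e <= 1)%N.
    apply: (gt2_count_le1 e_sym e_irr uv_cover (c := 1)) => //.
    - by rewrite expr1n.
    - exact: rmorph1.
    - by rewrite W0 eqxx.
  by rewrite e2.
left; have := common_neighbors_neq0 (negbT euv); rewrite -card_gt0 => q_gt0.
split=> //; rewrite ltnNge; apply/negP => le2.
(* The independent pair [u], [v] gives [n >= 4], while [p + q + r <= 2] gives [n <= 4]; what remains
   is P4 or C4. *)
have alpha_ge2 : (2 <= alpha e)%N.
  suff: (#|[set u; v]| <= alpha e)%N by rewrite cards2 uv.
  apply: independent_card_le; apply/forall_inP => x xA; apply/forall_inP => y yA.
  move: xA yA; rewrite !inE => /orP[]/eqP-> /orP[]/eqP->;
    by rewrite ?e_irr ?euv // e_sym euv.
have: (gt2_count e <= 1)%N.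
  apply: (gt2_count_le1 e_sym e_irr uv_cover (c := -1)) => //.
  - by rewrite sqrrN expr1n.
  - by rewrite rmorphN rmorph1.
  - lia.
  - by rewrite euv.
by rewrite e2.
Qed.

End ConnectedCover.

(** * The eigenvalue count of the three families, and the equivalence *)

Lemma gt2_count_bstar (T : finType) (e : rel T) p q r uv :
  symmetric e -> irreflexive e -> isomorphic e (bstar p q r uv) ->
  [\/ uv = false /\ ((1 <= q) && (3 <= p + q + r))%N,
      uv = true /\ ((q == 0) && (2 <= p * r))%N | uv = true /\ (1 <= q)%N] ->
  gt2_count e = 2.
Proof.
move=> e_sym e_irr /isomorphic_bstarP[l /cover_of_labelling[x [y []]]].
move=> xy_cover pE qE rE uvE num.
apply/eqP; rewrite eqn_leq (gt2_count_le2 e_sym e_irr xy_cover).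
apply: (gt2_count_ge2 e_sym e_irr xy_cover); rewrite pE qE ?rE uvE.
  by case: num => -[-> ?] /=; nia.
case: num {pE qE rE} => -[-> num] /=; last nia.
  (* The inequality is [16 q^2 < (2p + 5q - 2)(2r + 5q - 2)]. It follows from [4q < 5q - 2] for
     [q >= 3]; for [q] equal to 1 or 2 it needs [p + q + r >= 3], as P4 gives 15 against 16 and C4
     gives 64 on both sides. *)
  by case: q num => [|[|[|q]]] num; nia.
(* With [q = 0] and the edge [uv] it reads [1 < (2p - 1)(2r - 1)], so [p] and [r] are positive and
   not both 1. *)
by case/andP: num => /eqP->; case: p r => [|p] [|r] pr2; nia.
Qed.

Unset Implicit Arguments.
Local Close Scope sesquilinear_scope.

Theorem mainTheorem8 (T : finType) (e : rel T) :
  simple_graph e -> connected_graph e ->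
  (alpha e + 2)%N = #|T| ->
  (mG_closed e 0 (#|T| - alpha e)%:R = alpha e <->
   exists p q r : nat, (r <= p)%N /\
     ( ([/\ (1 <= q)%N, (3 <= p + q + r)%N & isomorphic e (bstar p q r false)])
     \/ ([/\ q = 0%N, (2 <= p * r)%N & isomorphic e (bstar p q r true)])
     \/ ((1 <= q)%N /\ isomorphic e (bstar p q r true)))).
Proof.
move=> [e_sym e_irr] e_conn eT.
have -> : (#|T| - alpha e)%N = 2 by rewrite -eT addKn.
have mG := mG_closed_0_2 e_sym e_irr.
(* The two counts add up to [n], which is [alpha e + 2]. *)
have -> : (mG_closed e 0 2%:R = alpha e) <-> gt2_count e = 2 by split; lia.
split=> [e2|[p [q [r [_ pqr]]]]].
  have [u [v uv_cover]] := exists_covering_pair eT.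
  (* Exchanging [u] and [v] if necessary ensures [r <= p]. *)
  have [le_rp|/ltnW le_pr] := leqP #|leaves e v u| #|leaves e u v|.
    exact: (binary_star_of_gt2_count e_sym e_irr e_conn uv_cover).
  exact: (binary_star_of_gt2_count e_sym e_irr e_conn (covering_pairC uv_cover)).
case: pqr => [[q1 n3 iso]|[[q0 pr2 iso]|[q1 iso]]];
  apply: (gt2_count_bstar e_sym e_irr iso).
- by constructor 1; rewrite q1 n3.
- by constructor 2; rewrite q0 pr2.
- by constructor 3.
Qed.
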